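(* Let $(\mathfrak g,\partial,[-,-])$ be a differential graded Lie algebra and $(\mathfrak h,\partial,[-,-])\subset \mathfrak g$ a differential graded Lie subalgebra such that $\mathfrak g^i/\mathfrak h^i$ is finite-dimensional for $i=0,1,2$. Let $\sigma_i:\mathfrak g^i/\mathfrak h^i\to\mathfrak g^i$ ($i=0,1$) be linear splittings of the quotient maps, and let $Q\in\mathfrak h^1$ be a Maurer–Cartan element. Assume: (a) $\mathfrak g^0,\mathfrak g^1,\mathfrak g^2$ are locally convex topological vector spaces and the projections $p_i:\mathfrak g^i\to\mathfrak g^i/\mathfrak h^i$ are continuous; (b) $\partial:\mathfrak g^1\to\mathfrak g^2$ is continuous; (c) $[-,-]:\mathfrak g^1\times\mathfrak g^1\to\mathfrak g^2$ is continuous; (d) there is an open neighbourhood $U$ of $0\in\mathfrak g^0/\mathfrak h^0$ such that for every $Q'\in\mathfrak g^1$ and $v\in U$ the gauge action $(Q')^{\sigma_0(v)}$ is defined, the map $U\times\mathfrak g^1\to\mathfrak g^1$, $(v,Q')\mapsto (Q')^{\sigma_0(v)}$ is jointly continuous, and for each fixed $Q'$ the class $(Q')^{\sigma_0(v)}+\mathfrak h^1\in\mathfrak g^1/\mathfrak h^1$ depends smoothly on $v\in U$; (e) for $v\in U$, $Q'\in\mathfrak g^1$ is Maurer–Cartan if and only if $(Q')^{\sigma_0(v)}$ is Maurer–Cartan. Assume moreover that $H^1(\mathfrak g/\mathfrak h,\overline{\partial+[Q,-]})=0$. Then for every open neighbourhood $V\subset U$ of $0$ there exists an open neighbourhood $\mathcal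 U$ of $Q$ in the set $MC(\mathfrak g)$ of Maurer–Cartan elements of $\mathfrak g$ (with the subspace topology of $\mathfrak g^1$) such that for every $Q'\in\mathcal U$ there is a subset $I\subset V$, which is the image of an injective map from an open neighbourhood of $0$ in $H^0(\mathfrak g/\mathfrak h,\overline{\partial+[Q,-]})$, such that $(Q')^{\sigma_0(v)}\in\mathfrak h^1$ for every $v\in I$.
   Context: A differential graded Lie algebra $(\mathfrak g,\partial,[-,-])$ is a non-negatively graded real vector space with a degree 1 linear map $\partial$ and a degree 0 graded skew-symmetric bilinear bracket satisfying $\partial^2=0$, $\partial[x,y]=[\partial x,y]+(-1)^{|x|}[x,\partial y]$ and the graded Jacobi identity $[[x,y],z]=[x,[y,z]]-(-1)^{|x||y|}[y,[x,z]]$. An element $Q\in\mathfrak g^1$ is Maurer–Cartan if $\partial Q+\frac12[Q,Q]=0$. For $Q\in\mathfrak g^1$, $v\in\mathfrak g^0$, the gauge action $Q^v$ is defined (when it exists) as $\gamma_1$, where $\gamma:[0,1]\to\mathfrak g^1$ is the unique solution of $\frac{d}{dt}\gamma_t=[v,\gamma_t]-\partial v$, $\gamma_0=Q$. Since $Q\in\mathfrak h^1$ is Maurer–Cartan, $\partial+[Q,-]$ is a differential on $\mathfrak g$ preserving $\mathfrak h$, and $\overline{\partial+[Q,-]}$ denotes the induced differential on the quotient complex $\mathfrak g/\mathfrak h$. *)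

(* Defs.v *)
From HB Require Import structures.
From mathcomp Require Import all_boot all_order all_algebra.
From mathcomp Require Import all_classical all_reals all_analysis.
Set Implicit Arguments.
Unset Strict Implicit.
Unset Printing Implicit Defensive.
Import Order.TTheory GRing.Theory Num.Theory.
Import numFieldNormedType.Exports.
Local Open Scope classical_set_scope.
Local Open Scope ring_scope.

Definition lin_map (R : realType) (A B : lmodType R) (f : A -> B) : Prop :=
  forall (a : R) (x y : A), f (a *: x + y) = a *: f x + f y.

Definition bilin_map (R : realType) (A B C : lmodType R) (b : A -> B -> C) : Prop :=
  (forall (a : R) (x x' : A) (y : B), b (a *: x + x') y = a *: b x y + b x' y) /\
  (forall (a : R) (x : A) (y y' : B), b x (a *: y + y') = a *: b x y + b x y').

(* A differential graded Lie algebra, in degrees 0, 1, 2.  *)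
(* d0 : g^0 -> g^1, d1 : g^1 -> g^2, and the brackets                  *)
(* b00 : g^0 x g^0 -> g^0, b01 : g^0 x g^1 -> g^1, b02 : g^0 x g^2 ->  *)
(* g^2, b11 : g^1 x g^1 -> g^2.  The brackets g^1 x g^0 and g^2 x g^0  *)
(* are determined by graded skew-symmetry: [x,v] = - [v,x] for v in    *)
(* degree 0.                                                           *)
Record is_dgla012 (R : realType) (G0 G1 G2 : lmodType R)
    (d0 : G0 -> G1) (d1 : G1 -> G2)
    (b00 : G0 -> G0 -> G0) (b01 : G0 -> G1 -> G1)
    (b02 : G0 -> G2 -> G2) (b11 : G1 -> G1 -> G2) : Prop := {
  dgla_d0_lin : lin_map d0;
  dgla_d1_lin : lin_map d1;
  dgla_dd : forall x, d1 (d0 x) = 0;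
  dgla_b00_bilin : bilin_map b00;
  dgla_b01_bilin : bilin_map b01;
  dgla_b02_bilin : bilin_map b02;
  dgla_b11_bilin : bilin_map b11;
  dgla_b00_skew : forall x y, b00 x y = - b00 y x;
  dgla_b11_sym : forall a c, b11 a c = b11 c a;
  (* Leibniz rule  d[x,y] = [dx,y] + (-1)^|x| [x,dy] *)
  dgla_leib00 : forall x y, d0 (b00 x y) = b01 x (d0 y) - b01 y (d0 x);
  dgla_leib01 : forall x a, d1 (b01 x a) = b11 (d0 x) a + b02 x (d1 a);
  (* graded Jacobi  [[x,y],z] = [x,[y,z]] - (-1)^(|x||y|) [y,[x,z]] *)
  dgla_jac000 : forall x y z, b00 (b00 x y) z = b00 x (b00 y z) - b00 y (b00 x z);
  dgla_jac001 : forall x y a, b01 (b00 x y) a = b01 x (b01 y a) - b01 y (b01 x a);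
  dgla_jac002 : forall x y e, b02 (b00 x y) e = b02 x (b02 y e) - b02 y (b02 x e);
  dgla_jac011 : forall x a c, b11 (b01 x a) c = b02 x (b11 a c) - b11 a (b01 x c)
}.

Definition is_subspace (R : realType) (A : lmodType R) (H : set A) : Prop :=
  H 0 /\ forall (a : R) x y, H x -> H y -> H (a *: x + y).

Record is_sub_dgla012 (R : realType) (G0 G1 G2 : lmodType R)
    (d0 : G0 -> G1) (d1 : G1 -> G2)
    (b00 : G0 -> G0 -> G0) (b01 : G0 -> G1 -> G1)
    (b02 : G0 -> G2 -> G2) (b11 : G1 -> G1 -> G2)
    (H0 : set G0) (H1 : set G1) (H2 : set G2) : Prop := {
  sub_H0 : is_subspace H0;
  sub_H1 : is_subspace H1;
  sub_H2 : is_subspace H2;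
  sub_d0 : forall x, H0 x -> H1 (d0 x);
  sub_d1 : forall a, H1 a -> H2 (d1 a);
  sub_b00 : forall x y, H0 x -> H0 y -> H0 (b00 x y);
  sub_b01 : forall x a, H0 x -> H1 a -> H1 (b01 x a);
  sub_b02 : forall x e, H0 x -> H2 e -> H2 (b02 x e);
  sub_b11 : forall a c, H1 a -> H1 c -> H2 (b11 a c)
}.

(* p : G -> R^n presents the finite-dimensional quotient G/H:          *)
(* p is linear, surjective, with kernel exactly H.                     *)
Definition is_quotient_map (R : realType) (G : lmodType R) (H : set G) (n : nat)
    (p : G -> 'rV[R]_n) : Prop :=
  lin_map p /\ (forall w, exists x, p x = w) /\ (forall x, p x = 0 <-> H x).

Definition is_splitting (R : realType) (G : lmodType R) (n : nat)
    (p : G -> 'rV[R]_n) (sigma : 'rV[R]_n -> G) : Prop :=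
  lin_map sigma /\ forall w, p (sigma w) = w.

Definition isMC (R : realType) (G1 G2 : lmodType R) (d1 : G1 -> G2)
    (b11 : G1 -> G1 -> G2) (Q : G1) : Prop :=
  d1 Q + (2%:R)^-1 *: b11 Q Q = 0.

(* derivative of a curve gamma : [0,1] -> E at t in [0,1] (one-sided at *)
(* the endpoints), E a topological vector space                        *)
Definition curve_deriv_at (R : realType) (E : tvsType R) (gamma : R -> E)
    (t : R) (dv : E) : Prop :=
  (fun h : R => h^-1 *: (gamma (t + h) - gamma t))
    @ within [set h : R | h != 0 /\ 0 <= t + h <= 1] (nbhs (0 : R)) --> dv.

Definition gauge_sol (R : realType) (G0 G1 : tvsType R) (d0 : G0 -> G1)
    (b01 : G0 -> G1 -> G1) (Q : G1) (v : G0) (gamma : R -> G1) : Prop :=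
  gamma 0 = Q /\
  forall t : R, 0 <= t <= 1 -> curve_deriv_at gamma t (b01 v (gamma t) - d0 v).

(* gauge_rel Q v Q'' : the gauge action Q^v is defined (the solution   *)
(* exists and is unique on [0,1]) and equals Q''                        *)
Definition gauge_rel (R : realType) (G0 G1 : tvsType R) (d0 : G0 -> G1)
    (b01 : G0 -> G1 -> G1) (Q : G1) (v : G0) (Q'' : G1) : Prop :=
  exists gamma : R -> G1,
    [/\ gauge_sol d0 b01 Q v gamma,
        (forall gamma', gauge_sol d0 b01 Q v gamma' ->
           forall t : R, 0 <= t <= 1 -> gamma' t = gamma t)
      & Q'' = gamma 1].

Fixpoint iter_derive (R : realType) (n m : nat) (ds : seq 'rV[R]_n)
    (f : 'rV[R]_n -> 'rV[R]_m) : 'rV[R]_n -> 'rV[R]_m :=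
  match ds with
  | [::] => f
  | d :: ds' => fun x => derive (iter_derive ds' f) x d
  end.

Definition smooth_on (R : realType) (n m : nat) (U : set 'rV[R]_n)
    (f : 'rV[R]_n -> 'rV[R]_m) : Prop :=
  forall (ds : seq 'rV[R]_n) (x : 'rV[R]_n), U x ->
    (forall d, derivable (iter_derive ds f) x d) /\
    {for x, continuous (iter_derive ds f)}.

(* Main.v *)
Require Import Defs.
From HB Require Import structures.
From mathcomp Require Import all_boot all_order all_algebra.
From mathcomp Require Import all_classical all_reals all_analysis.
From mathcomp Require Import ring lra zify.
Import Order.TTheory GRing.Theory Num.Theory.
Import numFieldNormedType.Exports.
Local Open Scope classical_set_scope.
Local Open Scope ring_scope.

(** Put [F v Q' := p1 (Phi v Q')].  By the gauge equation the derivative of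
    [F ^~ Q] at [0] is [- D], with [D] the induced differential from degree 0 to
    degree 1.  Choose coordinates [E] on the target that restrict to coordinates
    on the image of [D], and a linear section [B] of [D] over that image.

    Rigidity: modulo [H2] the Maurer-Cartan equation of [x] near [Q] is a linear
    equation in [p1 x] whose coefficients are close to the differential from
    degree 1 to degree 2.  As [H^1 = 0], the latter is injective on the kernel of
    [E], so a Maurer-Cartan element [x] near [Q] with [p1 x *m E = 0] lies in
    [H1].

    It remains to solve [F (k + c *m B) Q' *m E = 0] for [c], given [k] in [H^0]
    near [0] and [Q'] near [Q].  For [(k, Q') = (0, Q)] the left-hand side is
    [- c + o(c)].  As [F] is only jointly continuous, with no control on the
    derivatives for [Q' <> Q], the inverse function theorem is not available;
    but the left-hand side stays uniformly close to [- c] on a small box, and the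
    Poincare-Miranda theorem gives a zero [c k].  The map [k |-> k + c k *m B] is
    injective because [k] is recovered by projecting along the image of [B].

    Poincare-Miranda follows from a mod 2 Stokes theorem on a grid: the cup
    product of the coboundaries of the signs of the components sums to 1 over the
    grid, hence is nonzero on some cube, on which every component changes sign. *)

(** * A mod 2 Stokes theorem on a grid *)

Section DiscreteStokes.
Variable n : nat.
Local Notation grid := ('I_n -> nat).
Implicit Types (x y : grid) (i j a : 'I_n) (l : seq 'I_n) (J : {set 'I_n}).

Definition upd x j (k : nat) : grid := fun i => if i == j then k else x i.
Definition step j x : grid := upd x j (x j).+1.
Definition fdiff j (f : grid -> 'F_2) x : 'F_2 := f (step j x) - f x.

Lemma updC x i j k m : i != j -> upd (upd x i k) j m = upd (upd x j m) i k.
Proof.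
move=> ij; apply/funext => h; rewrite /upd.
by case: (eqVneq h j) => [->|//]; rewrite eq_sym (negbTE ij).
Qed.

Lemma stepC i j x : step i (step j x) = step j (step i x).
Proof.
have [->//|ij] := eqVneq i j.
rewrite /step [RHS]updC //.
by congr (upd (upd _ _ _) _ _); rewrite /upd ?(negbTE ij) // eq_sym (negbTE ij).
Qed.

Lemma step_bounds j x i : (x i <= step j x i <= (x i).+1)%N.
Proof. by rewrite /step /upd; case: eqP => [->|_]; lia. Qed.

Variable s : 'I_n -> grid -> 'F_2.

(* The value at the cube with corner [x] and directions [J] of the cubical
   cup product of the coboundaries of the [s a], for [a] in [l]. *)
Fixpoint cup l J x : 'F_2 :=
  if l is a :: l' then \sum_(j in J) fdiff j (s a) x * cup l' (J :\ j) (step j x)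
  else 1.

(** The terms at (j, i) and (i, j) are equal, so they cancel in characteristic 2. *)
Lemma sum_offdiag_symmetric (g : 'I_n -> 'I_n -> 'F_2) J :
  (forall i j, g i j = g j i) -> \sum_(j in J) \sum_(i in J :\ j) g j i = 0.
Proof.
move=> gC.
have split_lt j : \sum_(i in J :\ j) g j i =
    \sum_(i in J | (i < j)%N) g j i + \sum_(i in J | (j < i)%N) g j i.
  rewrite (bigID (fun i : 'I_n => (i < j)%N)) /=; congr (_ + _); apply: eq_bigl => i;
  by rewrite !inE -val_eqE /=; case: (i \in J); rewrite /= ?andbT ?andbF //; lia.
under eq_bigr do rewrite split_lt.
rewrite big_split /= [X in _ + X](exchange_big_dep (mem J)) //=; last first.
  by move=> i j _ /andP[].
under [X in _ + X]eq_bigr => j jJ.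
  under eq_bigl => i do rewrite jJ /=.
  under eq_bigr => i _ do rewrite gC.
over.
by rewrite addrr_pchar2 // pchar_Fp.
Qed.

(** A cup product of coboundaries is a cocycle. By induction on [l], the discrete Leibniz rule
    splits each difference into [g], a mixed second difference symmetric in the two directions, and
    [h], which the induction hypothesis kills. *)
Lemma cup_closed l J x : \sum_(j in J) fdiff j (cup l (J :\ j)) x = 0.
Proof.
elim: l J x => [|a l IH] J x; first by apply: big1 => j _; rewrite /fdiff subrr.
pose g j i := (fdiff i (s a) (step j x) - fdiff i (s a) x) *
              cup l (J :\ j :\ i) (step i (step j x)).
pose h j i := fdiff i (s a) x * fdiff j (cup l (J :\ i :\ j)) (step i x).
have D1C i j : J :\ i :\ j = J :\ j :\ i by apply/setP => k; rewrite !inE andbCA.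
have -> : \sum_(j in J) fdiff j (cup (a :: l) (J :\ j)) x =
    \sum_(j in J) \sum_(i in J :\ j) g j i + \sum_(j in J) \sum_(i in J :\ j) h j i.
  rewrite -big_split; apply: eq_bigr => j jJ.
  rewrite /fdiff /= -sumrB -big_split; apply: eq_bigr => i _.
  by rewrite /g /h (D1C i j) /fdiff (stepC j i) /=; ring.
rewrite sum_offdiag_symmetric ?add0r; last first.
  by move=> i j; rewrite /g D1C /fdiff (stepC j i); congr (_ * _); ring.
rewrite (exchange_big_dep (mem J)) /=; last by move=> j i _ /setD1P[].
apply: big1 => i iJ.
transitivity (fdiff i (s a) x * \sum_(j in J :\ i) fdiff j (cup l (J :\ i :\ j)) (step i x)).
  2: by rewrite IH mulr0.
rewrite mulr_sumr; apply: eq_big => // j.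
by rewrite !inE iJ andbT eq_sym andbC.
Qed.

(** The Leibniz rule for [s a] times the cup product over [l]; the other term vanishes because the
    latter is closed. *)
Lemma cup_exact a l J x :
  cup (a :: l) J x = \sum_(j in J) fdiff j (fun y => s a y * cup l (J :\ j) y) x.
Proof.
transitivity (cup (a :: l) J x + s a x * \sum_(j in J) fdiff j (cup l (J :\ j)) x).
  by rewrite cup_closed mulr0 addr0.
rewrite mulr_sumr /=.
by rewrite -big_split; apply: eq_bigr => j _; rewrite /fdiff /=; ring.
Qed.

(** The factor of [b] is a difference of [s b] along an edge of the cube, and [s b] is constant
    there. *)
Lemma cup_eq0 b l J x : b \in l ->
  (forall y, (forall i, i \notin J -> y i = x i) ->
     (forall i, (x i <= y i <= (x i).+1)%N) -> s b y = s b x) ->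
  cup l J x = 0.
Proof.
elim: l J x => // a l IH J x; rewrite inE => /predU1P bl sb /=.
rewrite big1 // => j jJ.
have sbj : s b (step j x) = s b x.
  apply: sb; last exact: step_bounds.
  by move=> i iJ; rewrite /step /upd; case: eqP iJ => // ->; rewrite jJ.
case: bl => [<-|bl]; first by rewrite /fdiff sbj subrr mul0r.
rewrite IH ?mulr0 // => y yE yb; rewrite sbj.
have yj : y j = (x j).+1 by rewrite yE ?setD11 // /step /upd eqxx.
apply: sb => [i iJ|i].
  rewrite yE ?inE ?(negbTE iJ) ?andbF // /step /upd.
  by case: eqP iJ => // ->; rewrite jJ.
have [->|ij] := eqVneq i j; first by rewrite yj; lia.
by have := yb i; rewrite /step /upd (negbTE ij).
Qed.

(** * Sums over boxes and the Stokes formula *)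

Variable N : nat.

(** Coordinates outside [l] stay frozen at those of [x], so the same sum also serves for faces of
    the grid. *)
Fixpoint boxsum l (f : grid -> 'F_2) x : 'F_2 :=
  if l is a :: l' then boxsum l' (fun y => \sum_(k < N) f (upd y a k)) x else f x.

Lemma eq_boxsum l f g x :
  (forall y, (forall i, i \notin l -> y i = x i) ->
     (forall i, i \in l -> (y i < N)%N) -> f y = g y) ->
  boxsum l f x = boxsum l g x.
Proof.
elim: l f g => [|a l IH] f g fg /=; first exact: fg.
apply: IH => y yx yN; apply: eq_bigr => k _; apply: fg => i; rewrite inE /upd.
  by rewrite negb_or => /andP[/negbTE-> /yx].
by case: eqP => //= _ /yN.
Qed.

Lemma boxsum_rem b l f x : b \in l ->
  boxsum l f x = boxsum (rem b l) (fun y => \sum_(k < N) f (upd y b k)) x.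
Proof.
elim: l f => // a l IH f; rewrite inE /= eq_sym.
have [->//|ab /= bl] := eqVneq a b.
rewrite IH //; apply: eq_boxsum => y _ _; rewrite exchange_big /=.
by apply: eq_bigr => k _; apply: eq_bigr => m _; rewrite updC // eq_sym.
Qed.

Lemma boxsum_sum (I : finType) (P : pred I) l (f : I -> grid -> 'F_2) x :
  boxsum l (fun y => \sum_(i | P i) f i y) x = \sum_(i | P i) boxsum l (f i) x.
Proof.
elim: l f => //= a l IH f; rewrite -IH.
by apply: eq_boxsum => y _ _; rewrite exchange_big.
Qed.

Lemma boxsum_eq0 l f x :
  (forall y, (forall i, i \notin l -> y i = x i) ->
     (forall i, i \in l -> (y i < N)%N) -> f y = 0) ->
  boxsum l f x = 0.
Proof.
move=> f0; rewrite (@eq_boxsum l f (fun y => \sum_(i in (pred0 : pred 'I_n)) f y) x).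
  by rewrite boxsum_sum big_pred0.
by move=> y yx yN; rewrite big_pred0 ?f0.
Qed.

Lemma sum_fdiff b f y :
  \sum_(k < N) fdiff b f (upd y b k) = f (upd y b N) - f (upd y b 0%N).
Proof.
rewrite -(big_mkord xpredT (fun k => fdiff b f (upd y b k))).
rewrite -(telescope_sumr (fun k => f (upd y b k))) //; apply: eq_bigr => k _.
rewrite /fdiff; congr (f _ - _); apply/funext => i.
by rewrite /step /upd eqxx; case: eqP.
Qed.

Hypothesis s0 : forall i x, (forall j, (x j <= N)%N) -> x i = 0%N -> s i x = 0.
Hypothesis s1 : forall i x, (forall j, (x j <= N)%N) -> x i = N -> s i x = 1.

(* Discrete Stokes: all faces but [x a = N] contribute zero, because the
   sign belonging to the direction of the face is constant on it. *)
Lemma boxsum_cup l x : uniq l -> (forall i, x i = N) ->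
  boxsum l (cup l [set i in l]) x = 1.
Proof.
move=> ul xN; elim: l ul => // a l IH; rewrite cons_uniq => /andP[al /[dup] ul /IH {IH}IH].
pose J := [set i in a :: l].
pose F j y := fdiff j (fun y => s a y * cup l (J :\ j) y) y.
have aJ : a \in J by rewrite !inE eqxx.
have updN y j k : (forall i, i \notin rem j (a :: l) -> y i = x i) ->
    (forall i, i \in rem j (a :: l) -> (y i < N)%N) -> (k <= N)%N ->
    forall i, (upd y j k i <= N)%N.
  move=> yx yN kN i; rewrite /upd; case: eqP => // _.
  have [/yN/ltnW//|/yx->] := boolP (i \in rem j (a :: l)).
  by rewrite xN.
transitivity (\sum_(j in J) boxsum (a :: l) (F j) x).
  by rewrite -boxsum_sum; apply: eq_boxsum => y _ _; rewrite cup_exact.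
have E j : j \in J -> boxsum (a :: l) (F j) x =
    boxsum (rem j (a :: l)) (fun y => s a (upd y j N) * cup l (J :\ j) (upd y j N) -
       s a (upd y j 0%N) * cup l (J :\ j) (upd y j 0%N)) x.
  rewrite inE => jl; rewrite (@boxsum_rem j) //.
  by apply: eq_boxsum => y _ _; rewrite sum_fdiff.
rewrite (bigD1 a) // big1 ?Monoid.mulm1 => [|j /andP[jJ ja]].
  (* On the face [y a = N] the sign [s a] is 1 and the sum is the one for [l], since [x a = N]; on
     the face [y a = 0] the sign is 0. *)
  rewrite E // -[RHS]IH /= eqxx; apply: eq_boxsum => y yx yN.
  have yx' i : i \notin rem a (a :: l) -> y i = x i by rewrite /= eqxx; apply: yx.
  have yN' i : i \in rem a (a :: l) -> (y i < N)%N by rewrite /= eqxx; apply: yN.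
  rewrite s1 ?s0 ?mul0r ?subr0 ?mul1r; first 1 last.
  - exact: updN.
  - by rewrite /upd eqxx.
  - exact: updN.
  - by rewrite /upd eqxx.
  congr cup.
    by apply/setP => i; rewrite !inE; case: eqP => //= ->; rewrite (negbTE al).
  by apply/funext => i; rewrite /upd; case: eqP => // ->; rewrite yx // xN.
have jl : j \in l by move: jJ; rewrite !inE (negbTE ja).
rewrite E //; apply: boxsum_eq0 => y yx yN.
have c0 k : (k <= N)%N -> (k == 0%N) || (k == N) -> cup l (J :\ j) (upd y j k) = 0.
  move=> kN k0N; apply: (@cup_eq0 j) => // z zE zb.
  have zj : z j = k by rewrite zE ?setD11 // /upd eqxx.
  have uj : upd y j k j = k by rewrite /upd eqxx.
  have zN i : (z i <= N)%N.
    have [->|ij] := eqVneq i j; first by rewrite zj.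
    have [il|il] := boolP (i \in rem j (a :: l)).
      have := zb i; rewrite /upd (negbTE ij) => /andP[_ /leq_trans]; apply.
      exact: yN.
    rewrite zE; first by rewrite /upd (negbTE ij) yx // xN.
    by apply: contra il; rewrite in_setD1 inE mem_rem_uniq /= ?al // !inE.
  have uN := updN y j k yx yN kN.
  case/orP: k0N => /eqP k0.
    by rewrite (s0 _ _ zN (etrans zj k0)) (s0 _ _ uN (etrans uj k0)).
  by rewrite (s1 _ _ zN (etrans zj k0)) (s1 _ _ uN (etrans uj k0)).
by rewrite !c0 ?mulr0 ?subrr ?eqxx ?orbT.
Qed.

Lemma exists_sign_changing_cube : exists x, (forall i, (x i < N)%N) /\
  forall i, exists y, (forall j, (x j <= y j <= (x j).+1)%N) /\ s i y != s i x.
Proof.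
apply: contrapT => nE.
have := @boxsum_cup (enum 'I_n) (fun=> N) (enum_uniq _) (fun=> erefl).
rewrite boxsum_eq0 => [/esym/eqP|y _ yN]; first by rewrite oner_eq0.
apply: contrapT => cn0; apply: nE; exists y; split=> [i|i].
  by apply: yN; rewrite mem_enum.
apply: contrapT => nz; apply: cn0; apply: (@cup_eq0 i) => [|z _ zb].
  by rewrite mem_enum.
by apply: contrapT => /eqP sz; apply: nz; exists z.
Qed.

End DiscreteStokes.

(** * The Poincare-Miranda theorem *)

Lemma le_mx_normP (R : realType) (m n : nat) (x : 'M[R]_(m, n)) (r : R) : 0 <= r ->
  (`|x| <= r) <-> (forall i j, `|x i j| <= r).
Proof.
move=> r0; rewrite [`|x|]/Num.norm /= mx_normrE; split.
  move=> /bigmax_leP[_ xr] i j; exact: (xr (i, j)).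
by move=> xr; apply/bigmax_leP; split => // -[i j] _.
Qed.

Lemma norm_entry_le (R : realType) (m n : nat) (x : 'M[R]_(m, n)) i j : `|x i j| <= `|x|.
Proof. exact: (le_mx_normP _ _ _ x _ (normr_ge0 x)).1. Qed.

Lemma compact_norm_le (R : realType) (m : nat) (r : R) :
  compact [set c : 'rV[R]_m | `|c| <= r].
Proof.
apply: bounded_closed_compact.
  by exists r; split; [exact: num_real|] => M rM c /= /le_trans; apply; exact: ltW.
by apply: closed_comp (@closed_le R r) => x _; exact: norm_continuous.
Qed.

(** Without a zero, each point has a component of strict sign on a neighbourhood, and compactness
    makes its size uniform. On a grid of that mesh the signs satisfy the boundary conditions of the
    discrete statement, whose sign-changing cube gives a contradiction. *)
Lemma poincare_miranda (R : realType) (m : nat) (r : R) (g : 'rV[R]_m -> 'rV[R]_m) :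
  0 < r ->
  (forall c : 'rV[R]_m, `|c| <= r -> {for c, continuous g}) ->
  (forall (c : 'rV[R]_m) i, `|c| <= r -> c 0 i = r -> 0 < g c 0 i) ->
  (forall (c : 'rV[R]_m) i, `|c| <= r -> c 0 i = - r -> g c 0 i < 0) ->
  exists2 c, `|c| <= r & g c = 0.
Proof.
move=> r0 gc gpos gneg; apply: contrapT => nz.
pose P (N : nat) (c : 'rV[R]_m) := exists i,
  (forall y, `|y - c| <= 2 * r / N.+1%:R -> 0 < g y 0 i) \/
  (forall y, `|y - c| <= 2 * r / N.+1%:R -> g y 0 i < 0).
have small (e : R) : 0 < e -> \forall N \near \oo, 2 * r / N.+1%:R < e.
  move=> e0; have re0 : 0 < e / (2 * r) by rewrite divr_gt0 // mulr_gt0.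
  near=> N.
  have /= : (N.+1%:R)^-1 < e / (2 * r).
    by near: N; exact: near_infty_natSinv_lt (PosNum re0).
  by rewrite ltr_pdivlMr ?mulr_gt0 // mulrC.
have near_sign (c : 'rV[R]_m) (A : set 'rV[R]_m) : nbhs c A ->
    \forall c' \near c & N \near \oo, forall y, `|y - c'| <= 2 * r / N.+1%:R -> A y.
  move=> /nbhs_ballP[e /= e0 cA]; have e20 : 0 < e / 2 by rewrite divr_gt0.
  near=> c' N.
  have cc' : `|c - c'| < e / 2 by near: c'; have := nbhsx_ballx c _ e20; rewrite -ball_normE.
  have hN : 2 * r / N.+1%:R < e / 2 by near: N; exact: small.
  move=> y yc; apply: cA; rewrite -ball_normE /=.
  have -> : c - y = (c - c') - (y - c') by rewrite opprB addrA subrK.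
  apply: le_lt_trans (ler_normB _ _) _; rewrite (splitr e); apply: ltrD => //.
  exact: le_lt_trans yc hN.
have [M _ PM] : \forall N \near \oo, [set c : 'rV[R]_m | `|c| <= r] `<=` P N.
  apply: (compact_near_coveringP _).1; first exact: compact_norm_le.
  move=> c cr.
  have [i gi] : exists i, g c 0 i != 0.
    apply: contrapT => gi; apply: nz; exists c => //; apply/rowP => i; rewrite mxE.
    by apply: contrapT => /eqP gi0; apply: gi; exists i.
  have gci : {for c, continuous (fun y => g y 0 i)}.
    exact: (continuous_comp (gc c cr) (@coord_continuous _ _ _ _ _ _)).
  case/orP: (lt_total gi) => gi'.
    have /near_sign : nbhs c [set y | g y 0 i < 0].
      exact: (gci _ (lt_nbhsl gi')).
    by apply: filter_app; near=> c' N => ?; exists i; right.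
  have /near_sign : nbhs c [set y | 0 < g y 0 i].
    exact: (gci _ (lt_nbhsr gi')).
  by apply: filter_app; near=> c' N => ?; exists i; left.
(* The spacing [2 * r / N] is exactly the radius in [P M], so in the sup norm the ball about a grid
   point contains the cube with that corner. *)
pose N := M.+1.
pose pt (x : 'I_m -> nat) : 'rV[R]_m := \row_i (- r + 2 * r / N%:R * (x i)%:R).
pose s i x : 'F_2 := if 0 < g (pt x) 0 i then 1 else 0.
have N0 : 0 < N%:R :> R by rewrite ltr0n.
have h0 : 0 < 2 * r / N%:R by rewrite divr_gt0 // mulr_gt0.
have ptr x : (forall j, (x j <= N)%N) -> `|pt x| <= r.
  move=> xN; apply/le_mx_normP => [|i j]; first exact: ltW.
  have : 2 * r / N%:R * (x j)%:R <= 2 * r / N%:R * N%:R by rewrite ler_pM2l // ler_nat.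
  have : 0 <= 2 * r / N%:R * (x j)%:R by rewrite mulr_ge0 // ltW.
  by rewrite divfK ?lt0r_neq0 // mxE ler_norml => ? ?; apply/andP; split; lra.
have [x [xN sx]] : exists x, (forall i, (x i < N)%N) /\
  forall i, exists y, (forall j, (x j <= y j <= (x j).+1)%N) /\ s i y != s i x.
  apply: exists_sign_changing_cube => i x xN xi; rewrite /s.
    by rewrite ltNge ltW // gneg ?ptr // mxE xi mulr0 addr0.
  by rewrite gpos ?ptr // mxE xi divfK ?lt0r_neq0 //; ring.
have [i sg] := PM M (leqnn _) (pt x) (ptr x (fun j => ltnW (xN j))).
have [y [xy /eqP]] := sx i; apply; rewrite /s.
have yx : `|pt y - pt x| <= 2 * r / N%:R.
  apply/le_mx_normP => [|k j]; first exact: ltW.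
  rewrite !mxE opprD addrACA subrr add0r -mulrBr normrM gtr0_norm // ger_pMr //.
  have /andP[xy1 xy2] := xy j.
  by rewrite -natrB // normr_nat lern1 leq_subLR addn1.
have xx : `|pt x - pt x| <= 2 * r / N%:R by rewrite subrr normr0 ltW.
case: sg => sg; first by rewrite !sg.
by rewrite ![0 < _]ltNge !ltW // sg.
Unshelve. all: by end_near. Qed.

(** * Convergence of matrices and differentiability from partial derivatives *)

Lemma cvg_mx_entry (R : realType) (m n : nat) (T : Type) {F : set_system T}
    {FF : Filter F} (f : T -> 'M[R]_(m, n)) (A : 'M[R]_(m, n)) :
  (forall i j, (fun t => f t i j) @ F --> A i j) -> f @ F --> A.
Proof.
move=> fA B [P /= AP PB].
have : \forall t \near F, forall i j, P i j (f t i j).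
  by apply: filter_forall => i; apply: filter_forall => j; exact: fA.
by apply: filterS => t; exact: PB.
Qed.

Lemma cvg_entry (R : realType) (m n : nat) (T : Type) {F : set_system T}
    {FF : Filter F} (f : T -> 'M[R]_(m, n)) (A : 'M[R]_(m, n)) i j :
  f @ F --> A -> (fun t => f t i j) @ F --> A i j.
Proof. by move=> fA; exact: (cvg_comp _ _ fA (@coord_continuous _ _ _ i j A)). Qed.

Lemma cvg_mulmxr (R : realType) (m n p : nat) (T : Type) {F : set_system T}
    {FF : Filter F} (f : T -> 'M[R]_(m, n)) (A : 'M[R]_(m, n)) (B : 'M[R]_(n, p)) :
  f @ F --> A -> (fun t => f t *m B) @ F --> A *m B.
Proof.
move=> fA; apply: cvg_mx_entry => i j; rewrite mxE.
under eq_fun do rewrite mxE.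
apply: cvg_big => [|k _]; first exact: add_continuous.
by apply: cvgMl; exact: cvg_entry.
Qed.

Lemma cvg_det (R : realType) (n : nat) (T : Type) {F : set_system T}
    {FF : Filter F} (f : T -> 'M[R]_n) (A : 'M[R]_n) :
  f @ F --> A -> (fun t => \det (f t)) @ F --> \det A.
Proof.
move=> fA; apply: cvg_big => [|s _]; first exact: add_continuous.
apply: cvgMr; apply: cvg_big => [|k _]; first exact: mul_continuous.
exact: cvg_entry.
Qed.

Lemma is_derive_line_entry (R : realType) (n m : nat) (f : 'rV[R]_n -> 'rV[R]_m)
    (x e : 'rV[R]_n) (t : R) (j : 'I_m) :
  derivable f (x + t *: e) e ->
  is_derive t 1 (fun t : R => f (x + t *: e) 0 j) ('D_e f (x + t *: e) 0 j).
Proof.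
move=> df.
have D : h^-1 *: (((fun t => f (x + t *: e) 0 j) \o shift t) (h *: 1) - f (x + t *: e) 0 j)
    @[h --> (0:R)^'] --> 'D_e f (x + t *: e) 0 j.
  apply: cvg_trans (cvg_entry _ _ _ _ _ _ 0 j df); apply: near_eq_cvg; near=> h => /=.
  rewrite !mxE /= [h *: 1]mulr1 scalerDl addrCA [x + _]addrC.
  by congr (_ * (_ - _)).
by apply: DeriveDef; [apply/cvg_ex; eexists; exact: D | exact: cvg_lim D].
Unshelve. all: by end_near. Qed.

(** Both signs of [a] are covered, since the coordinate increments to which this is applied may be
    negative. *)
Lemma MVT_from0 (R : realType) (f df : R -> R) (a : R) :
  (forall t : R, `|t| <= `|a| -> is_derive t (1 : R) f (df t)) ->
  exists2 c : R, `|c| <= `|a| & f a - f 0 = df c * a.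
Proof.
move=> fdf.
have fc u v : (forall t, t \in `[u, v] -> `|t| <= `|a|) -> {within `[u, v], continuous f}.
  move=> uv; apply: derivable_within_continuous => t /uv/fdf tf.
  exact: ex_derive.
have [a0|a0] := leP 0 a.
  have I t : t \in `[0, a] -> `|t| <= `|a|.
    by rewrite in_itv /= => /andP[t0 ta]; rewrite !ger0_norm.
  have [|c /I cI E] := MVT_segment a0 _ (fc _ _ I) (df := df).
    by move=> t /subset_itv_oo_cc/I/fdf.
  by exists c => //; rewrite E subr0.
have I t : t \in `[a, 0] -> `|t| <= `|a|.
  by rewrite in_itv /= => /andP[ta t0]; rewrite !ler0_norm // ?lerN2 // ltW.
have [|c /I cI E] := MVT_segment (ltW a0) _ (fc _ _ I) (df := df).
  by move=> t /subset_itv_oo_cc/I/fdf.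
by exists c => //; rewrite -opprB E sub0r mulrN opprK.
Qed.

(** Move from 0 to [v] one coordinate at a time and apply the mean value theorem to each entry;
    continuity of the partials at 0 bounds every increment. *)
Lemma differentiable0_of_partials (R : realType) (n m : nat) (U : set 'rV[R]_n)
    (f : 'rV[R]_n -> 'rV[R]_m) (A : 'M[R]_(n, m)) :
  nbhs (0 : 'rV[R]_n) U ->
  (forall x i, U x -> derivable f x (delta_mx 0 i)) ->
  (forall i, {for (0 : 'rV[R]_n), continuous (fun x : 'rV[R]_n => 'D_(delta_mx 0 i) f x)}) ->
  (forall i, 'D_(delta_mx 0 i) f 0 = row i A) ->
  forall e : R, 0 < e ->
  \forall v \near (0 : 'rV[R]_n), `|f v - f 0 - v *m A| <= e * `|v|.
Proof.
move=> U0 df dfc df0 e e0.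
(* The error is shared among [n] increments; [n.+1] keeps the denominator nonzero when [n = 0]. *)
pose e' := e / n.+1%:R; have e'0 : 0 < e' by rewrite divr_gt0 // ltr0n.
have : \forall x \near (0 : 'rV[R]_n),
    U x /\ forall i, `|row i A - 'D_(delta_mx 0 i) f x| < e'.
  near=> x; split; first by near: x.
  near: x; apply: filter_forall => i.
  by have := dfc i; rewrite /prop_for /continuous_at df0 => /cvgrPdist_lt; apply.
move=> /nbhs_ballP[d /= d0]; rewrite -ball_normE => dU.
have {}dU x : `|x| < d -> U x /\ forall i, `|row i A - 'D_(delta_mx 0 i) f x| < e'.
  by move=> xd; apply: dU; rewrite /= sub0r normrN.
near=> v.
have vd : `|v| < d.
  near: v; have := nbhsx_ballx (0 : 'rV[R]_n) _ d0; rewrite -ball_normE.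
  by apply: filterS => v; rewrite /= sub0r normrN.
(* [w k] keeps the first [k] coordinates of [v]; in the sup norm the whole path stays in the ball of
   radius [d]. *)
pose w (k : nat) : 'rV[R]_n := \row_j (if (j < k)%N then v 0 j else 0).
have wS (k : 'I_n) : w k.+1 = w k + v 0 k *: delta_mx 0 k.
  apply/rowP => j; rewrite !mxE eqxx ltnS leq_eqVlt val_eqE.
  have [->|jk] := eqVneq j k; first by rewrite ltnn add0r mulr1.
  by rewrite mulr0 addr0.
have wd (k : 'I_n) t : `|t| <= `|v 0 k| -> `|w k + t *: delta_mx 0 k| < d.
  move=> tv; apply: le_lt_trans vd; apply/le_mx_normP => // i j.
  rewrite !mxE (ord1 i) eqxx; have [->|jk] := eqVneq j k.
    by rewrite ltnn mulr1 add0r; apply: le_trans tv _; exact: norm_entry_le.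
  by rewrite mulr0 addr0; case: ifP => _; rewrite ?normr0 //; exact: norm_entry_le.
have step (k : 'I_n) : `|f (w k.+1) - f (w k) - v 0 k *: row k A| <= e' * `|v|.
  apply/le_mx_normP => [|i j]; first by rewrite mulr_ge0 // ltW.
  rewrite (ord1 i).
  have [|c cv E] := @MVT_from0 _ (fun t : R => f (w k + t *: delta_mx 0 k) 0 j)
    (fun t : R => 'D_(delta_mx 0 k) f (w k + t *: delta_mx 0 k) 0 j) (v 0 k).
    by move=> t /wd/dU[Ut _]; apply: is_derive_line_entry; exact: df.
  move: E; rewrite /= scale0r addr0 -wS => E.
  rewrite !mxE /= E mulrC -mulrBr normrM mulrC; apply: ler_pM => //; last first.
    exact: norm_entry_le.
  have [_ /(_ k)] := dU _ (wd _ _ cv); rewrite distrC => /ltW; apply: le_trans.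
  have := norm_entry_le _ _ _ ('D_(delta_mx 0 k) f (w k + c *: delta_mx 0 k) - row k A) 0 j.
  by rewrite !mxE.
have wn : w n = v by apply/rowP => j; rewrite mxE ltn_ord.
have w0 : w 0%N = 0 by apply/rowP => j; rewrite !mxE.
have -> : f v - f 0 - v *m A =
    \sum_(k < n) (f (w k.+1) - f (w k) - v 0 k *: row k A).
  rewrite sumrB -(big_mkord xpredT (fun k => f (w k.+1) - f (w k))).
  by rewrite telescope_sumr // wn w0 mulmx_sum_row.
apply: le_trans (ler_norm_sum _ _ _) _.
apply: (@le_trans _ _ (\sum_(k < n) e' * `|v|)); first by apply: ler_sum => k _.
rewrite sumr_const card_ord -mulr_natl mulrA; apply: ler_wpM2r => //.
by rewrite /e' mulrCA ger_pMr // ler_pdivrMr ?ltr0n // mul1r ler_nat.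
Unshelve. all: by end_near. Qed.

(** * Linear maps and the derivative of the gauge action *)

Section LinMap.
Context {R : realType} {A B : lmodType R} {f : A -> B}.
Hypothesis fL : lin_map f.

Lemma lin_mapD x y : f (x + y) = f x + f y.
Proof. by have := fL 1 x y; rewrite !scale1r. Qed.

Lemma lin_map0 : f 0 = 0.
Proof. by apply: (addrI (f 0)); rewrite -lin_mapD !addr0. Qed.

Lemma lin_mapZ a x : f (a *: x) = a *: f x.
Proof. by have := fL a x 0; rewrite lin_map0 !addr0. Qed.

Lemma lin_mapN x : f (- x) = - f x.
Proof. by rewrite -[- x]scaleN1r lin_mapZ scaleN1r. Qed.

Lemma lin_mapB x y : f (x - y) = f x - f y.
Proof. by rewrite lin_mapD lin_mapN. Qed.

End LinMap.

Lemma lin_mapE (R : realType) (n : nat) (B : lmodType R) (f : 'rV[R]_n -> B) w :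
  lin_map f -> f w = \sum_i w 0 i *: f (delta_mx 0 i).
Proof.
move=> fL; rewrite {1}[w]row_sum_delta.
elim/big_rec2 : _ => [|i _ y _ <-]; first exact: lin_map0.
by rewrite (lin_mapD fL) (lin_mapZ fL).
Qed.

Lemma tvs_scaler_continuous (R : realType) (E : tvsType R) (a : R) :
  continuous (fun x : E => a *: x).
Proof.
move=> x; apply: (@continuous_comp E (R^o * E)%type E (fun x => (a, x))
  (fun x => x.1 *: x.2)); last exact: scale_continuous.
by apply: (@cvg_pair _ _ _ _ (nbhs (a : R^o))); [exact: cvg_cst|exact: cvg_id].
Qed.

(** * Rescaling of gauge solutions and the derivative of an orbit *)

Section Gauge.
Context {R : realType} {G0 G1 : tvsType R} {d0 : G0 -> G1} {b01 : G0 -> G1 -> G1}.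
Hypotheses (d0L : lin_map d0) (b01L : bilin_map b01).

(** Chain rule for a linear reparametrisation; [a <= 1] keeps [a * t] in the interval where [gamma]
    solves the equation. *)
Lemma gauge_sol_scale (Q : G1) (v : G0) (gamma : R -> G1) (a : R) : 0 < a <= 1 ->
  gauge_sol d0 b01 Q v gamma ->
  gauge_sol d0 b01 Q (a *: v) (fun t => gamma (a * t)).
Proof.
move=> /andP[a0 a1] [g0 gd]; split; first by rewrite mulr0.
move=> t /andP[t0 t1].
have at01 : 0 <= a * t <= 1.
  by rewrite mulr_ge0 ?(ltW a0) //= mulr_ile1 ?(ltW a0).
have -> : b01 (a *: v) (gamma (a * t)) - d0 (a *: v) =
    a *: (b01 v (gamma (a * t)) - d0 v).
  rewrite (lin_mapZ d0L) scalerBr; congr (_ - _).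
  exact: (@lin_mapZ _ _ _ (b01^~ (gamma (a * t))) (fun k x x' => b01L.1 k x x' _)).
have D := gd _ at01.
have S : (fun h => a * h) @ within [set h : R | h != 0 /\ 0 <= t + h <= 1] (nbhs (0 : R))
    --> within [set h : R | h != 0 /\ 0 <= a * t + h <= 1] (nbhs (0 : R)).
  move=> B; rewrite /within /= => nB.
  have m0 : a * h @[h --> (0:R)] --> (0 : R).
    by rewrite -[X in _ --> X](mulr0 a); apply: cvgMr; exact: cvg_id.
  suff : \forall h \near (0 : R), h != 0 /\ 0 <= t + h <= 1 -> B (a * h) by [].
  have : \forall h \near (0 : R), a * h != 0 /\ 0 <= a * t + a * h <= 1 -> B (a * h).
    exact: (m0 _ nB).
  apply: filterS => h /= hB [h0 /andP[th0 th1]].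
  apply: hB; split; first by rewrite mulf_neq0 // gt_eqF.
  by rewrite -mulrDr mulr_ge0 ?(ltW a0) //= mulr_ile1 ?(ltW a0).
have := cvg_comp _ _ (cvg_comp _ _ S D) (@tvs_scaler_continuous _ G1 a _).
apply: cvg_trans; apply: near_eq_cvg; near=> h => /=.
by rewrite scalerA invfM mulrA divff ?mul1r ?mulrDr // gt_eqF.
Unshelve. all: by end_near. Qed.

Lemma gauge_sol0 (Q : G1) : gauge_sol d0 b01 Q 0 (fun=> Q).
Proof.
split=> // t _; rewrite (lin_map0 d0L) subr0.
rewrite (@lin_map0 _ _ _ (b01^~ Q) (fun k x x' => b01L.1 k x x' _)).
by rewrite /curve_deriv_at; under eq_fun do rewrite subrr scaler0; exact: cvg_cst.
Qed.

Lemma gauge_rel_sol (Q Q' : G1) (v : G0) (gamma : R -> G1) :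
  gauge_rel d0 b01 Q v Q' -> gauge_sol d0 b01 Q v gamma -> Q' = gamma 1.
Proof.
by move=> [g [_ gu ->]] /gu/(_ 1) ->//; rewrite ler01 lexx.
Qed.

(** By rescaling and uniqueness, a single solution [gamma] traces the orbit along the ray through
    [u], so the directional derivative is read off from the gauge equation at time 0. *)
Lemma derive_gauge_orbit (n0 n1 : nat) (p1 : G1 -> 'rV[R]_n1) (sigma : 'rV[R]_n0 -> G0)
    (U : set 'rV[R]_n0) (Q : G1) (Phi : 'rV[R]_n0 -> G1) (u : 'rV[R]_n0) :
  lin_map p1 -> continuous p1 -> lin_map sigma -> nbhs (0 : 'rV[R]_n0) U ->
  (forall v, U v -> gauge_rel d0 b01 Q (sigma v) (Phi v)) ->
  derivable (fun v => p1 (Phi v)) 0 u ->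
  'D_u (fun v => p1 (Phi v)) 0 = p1 (b01 (sigma u) Q - d0 (sigma u)).
Proof.
move=> p1L p1c sL /nbhs_ballP[d /= d0']; rewrite -ball_normE => dU hPhi df.
have {}dU v : `|v| < d -> U v by move=> vd; apply: dU; rewrite /= sub0r normrN.
have u1 : 0 < `|u| + 1 by rewrite ltr_pwDr.
(* [s] shrinks [u] so that the segment from 0 to [s *: u] lies in [U]; the [+ 1] in the denominator
   allows [u = 0]. The factor is cancelled at the end. *)
have [s s0 su] : exists2 s, 0 < s & s * `|u| < d.
  exists (d / (`|u| + 1)); first by rewrite divr_gt0.
  by rewrite mulrAC -mulrA gtr_pMr // ltr_pdivrMr // mul1r ltrDl.
have sU t : 0 <= t <= 1 -> U (t *: (s *: u)).
  move=> /andP[t0 t1]; apply: dU; rewrite !normrZ (ger0_norm t0) (gtr0_norm s0).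
  by apply: le_lt_trans su; rewrite ler_piMl // mulr_ge0 // ltW.
have [gamma [gsol _ _]] : gauge_rel d0 b01 Q (sigma (s *: u)) (Phi (s *: u)).
  by apply: hPhi; rewrite -[s *: u]scale1r; apply: sU; rewrite ler01 lexx.
have Phig t : 0 < t <= 1 -> Phi (t *: (s *: u)) = gamma t.
  move=> t01; rewrite -[t in RHS]mulr1; case/andP: (t01) => t0 t1.
  apply: (@gauge_rel_sol Q _ (sigma (t *: (s *: u))) (fun r => gamma (t * r))).
    by apply: hPhi; apply: sU; rewrite (ltW t0).
  by rewrite (lin_mapZ sL); exact: gauge_sol_scale.
have Phi0 : Phi 0 = gamma 0.
  rewrite gsol.1; apply: (@gauge_rel_sol Q _ (sigma 0) (fun=> Q)).
    by apply: hPhi; rewrite -(scale0r (s *: u)); apply: sU; rewrite lexx ler01.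
  by rewrite (lin_map0 sL); exact: gauge_sol0.
pose L w := b01 (sigma w) Q - d0 (sigma w).
have LZ w : L (s *: w) = s *: L w.
  rewrite /L (lin_mapZ sL) (lin_mapZ d0L) scalerBr; congr (_ - _).
  exact: (@lin_mapZ _ _ _ (b01^~ Q) (fun k x x' => b01L.1 k x x' _)).
(* [gamma] is controlled only on [0,1], so the two derivatives are compared through limits from the
   right. *)
have lim1 : t^-1 *: (p1 (gamma t) - p1 (gamma 0)) @[t --> (0 : R)^'+] --> p1 (L (s *: u)).
  have := gsol.2 0; rewrite lexx ler01 => /(_ isT); rewrite gsol.1 => D.
  have S : (0 : R)^'+ `=>` within [set h : R | h != 0 /\ 0 <= 0 + h <= 1] (nbhs (0 : R)).
    move=> B nB; suff : \forall h \near (0 : R), 0 < h -> B h by [].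
    have near1 : \forall h \near (0 : R), h < 1 by exact: lt_nbhsl ltr01.
    have nearB : \forall h \near (0 : R), h != 0 /\ 0 <= 0 + h <= 1 -> B h by exact: nB.
    apply: filterS2 near1 nearB => h h1 hB h0.
    by apply: hB; rewrite gt_eqF // add0r !ltW.
  have := cvg_comp _ _ (cvg_trans (cvg_app _ S) D) (p1c _).
  apply: cvg_trans; apply: near_eq_cvg; near=> h => /=.
  by rewrite (lin_mapZ p1L) (lin_mapB p1L) add0r gsol.1.
have lim2 : t^-1 *: (p1 (gamma t) - p1 (gamma 0)) @[t --> (0 : R)^'+] -->
    s *: 'D_u (fun v => p1 (Phi v)) 0.
  have S : (fun t => s * t) @ (0 : R)^'+ `=>` (0 : R)^'.
    move=> B; rewrite /dnbhs /within /= => nB.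
    have m0 : s * h @[h --> (0:R)] --> (0 : R).
      by rewrite -[X in _ --> X](mulr0 s); apply: cvgMr; exact: cvg_id.
    suff : \forall h \near (0 : R), 0 < h -> B (s * h) by [].
    have : \forall h \near (0 : R), s * h != 0 -> B (s * h) by exact: (m0 _ nB).
    apply: filterS => h /= hB h0.
    by apply: hB; rewrite mulf_neq0 // gt_eqF.
  have := cvg_comp _ _ (cvg_comp _ _ S df) (@scaler_continuous _ 'rV[R]_n1 s _).
  apply: cvg_trans; apply: near_eq_cvg; near=> t => /=.
  have t01 : 0 < t <= 1.
    apply/andP; split; first by near: t; exact: nbhs_right_gt.
    by near: t; exact: nbhs_right_le.
  rewrite scalerA invfM mulrA divff ?mul1r ?gt_eqF // addr0 -Phig // -Phi0.
  by rewrite scalerA [t * s]mulrC.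
have := cvg_unique (@norm_hausdorff R 'rV[R]_n1) lim1 lim2; rewrite LZ (lin_mapZ p1L) => E.
have sn0 : s != 0 by rewrite gt_eqF.
by rewrite -[LHS](scalerK sn0) -E scalerK.
Unshelve. all: by end_near. Qed.

End Gauge.

(** * Rigidity of Maurer-Cartan elements and the main theorem *)

Lemma cvg_pair_pt {T : Type} {X Y : topologicalType} {F : set_system T}
    {FF : Filter F} {f : T -> X} {g : T -> Y} {x : X} {y : Y} :
  f @ F --> x -> g @ F --> y -> (fun t => (f t, g t)) @ F --> (x, y).
Proof. exact: cvg_pair. Qed.

Lemma lin_map_mulmx (R : realType) (n m : nat) (f : 'rV[R]_n -> 'rV[R]_m) w :
  lin_map f -> f w = w *m \matrix_i f (delta_mx 0 i).
Proof.
by move=> fL; rewrite mulmx_sum_row lin_mapE //; apply: eq_bigr => i _; rewrite rowK.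
Qed.

Lemma lin_map_continuous (R : realType) (n m : nat) (f : 'rV[R]_n -> 'rV[R]_m) :
  lin_map f -> continuous f.
Proof.
move=> fL; have -> : f = fun w => w *m \matrix_i f (delta_mx 0 i).
  by apply/funext => w; exact: lin_map_mulmx.
by move=> w; apply: (@cvg_mulmxr _ _ _ _ _ (nbhs w)); exact: cvg_id.
Qed.

Lemma norm_mulmxr_le (R : realType) (n m : nat) (A : 'M[R]_(n, m)) :
  exists2 C : R, 0 < C & forall w : 'rV[R]_n, `|w *m A| <= C * `|w|.
Proof.
have [] := @linear_lipschitz _ _ _ (mulmxr A : {linear 'rV[R]_n -> 'rV[R]_m}).
  by move=> w; apply: (@cvg_mulmxr _ _ _ _ _ (nbhs w)); exact: cvg_id.
by move=> C C0 CA; exists C.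
Qed.

(* With [w := p1 x] and [h := x - sigma1 w], an element of [H1], the
   Maurer-Cartan equation of [x] modulo [H2] is linear in [w] once the
   quadratic term is absorbed into the coefficient matrix [M x], which depends
   continuously on [x]. *)
Lemma isMC_rigidity (R : realType) (G1 G2 : tvsType R) (d1 : G1 -> G2)
    (b11 : G1 -> G1 -> G2) (H1 : set G1) (H2 : set G2) (n1 n2 m : nat)
    (p1 : G1 -> 'rV[R]_n1) (p2 : G2 -> 'rV[R]_n2) (sigma1 : 'rV[R]_n1 -> G1)
    (Q : G1) (E : 'M[R]_(n1, m)) :
  lin_map d1 -> bilin_map b11 -> (forall a c, b11 a c = b11 c a) ->
  is_subspace H2 ->
  (forall a, H1 a -> H2 (d1 a)) -> (forall a c, H1 a -> H1 c -> H2 (b11 a c)) ->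
  is_quotient_map H1 p1 -> is_quotient_map H2 p2 -> is_splitting p1 sigma1 ->
  continuous p1 -> continuous p2 ->
  continuous (fun x : G1 * G1 => b11 x.1 x.2) -> H1 Q ->
  (forall w, w *m E = 0 -> p2 (d1 (sigma1 w) + b11 Q (sigma1 w)) = 0 -> w = 0) ->
  \forall x \near Q, isMC d1 b11 x -> p1 x *m E = 0 -> p1 x = 0.
Proof.
move=> d1L b11L b11C H2s H1d H1b [p1L [_ p1H]] [p2L [_ p2H]] [s1L s1K] p1c p2c b11c QH inj.
have bl a : lin_map (b11 a) by move=> k y y'; exact: b11L.2.
have br c : lin_map (b11^~ c) by move=> k y y'; exact: b11L.1.
pose T (x : G1) (w : 'rV[R]_n1) := p2 (d1 (sigma1 w)) + p2 (b11 x (sigma1 w)) -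
  2%:R^-1 *: p2 (b11 (sigma1 (p1 x)) (sigma1 w)).
have TL x : lin_map (T x).
  move=> a w w'; rewrite /T s1L d1L !(bl _ a) !p2L !scalerDr !scalerN !scalerA.
  rewrite [_^-1 * a]mulrC !opprD; apply/rowP => i; rewrite !mxE; ring.
pose M x := \matrix_i T x (delta_mx 0 i).
have p1Q : p1 Q = 0 by exact/p1H.
have TQ w : T Q w = p2 (d1 (sigma1 w) + b11 Q (sigma1 w)).
  rewrite /T p1Q (lin_map0 s1L) (lin_map0 (br _)) (lin_map0 p2L) scaler0 subr0.
  by rewrite -(lin_mapD p2L).
have T0 x : isMC d1 b11 x -> T x (p1 x) = 0.
  rewrite /isMC => mcx; set w := p1 x; pose h := x - sigma1 w.
  have hH : H1 h by apply/p1H; rewrite /h (lin_mapB p1L) s1K subrr.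
  have : p2 (d1 h + 2%:R^-1 *: b11 h h) = 0.
    by apply/p2H; rewrite addrC; apply: H2s.2; [exact: H1b|exact: H1d].
  (* Expansion of the square, with cross terms merged by symmetry of [b11]; for Maurer-Cartan [x]
     the right-hand side projects to [- T x w]. *)
  have -> : d1 h + 2%:R^-1 *: b11 h h = (d1 x + 2%:R^-1 *: b11 x x) - d1 (sigma1 w)
     - b11 x (sigma1 w) + 2%:R^-1 *: b11 (sigma1 w) (sigma1 w).
    rewrite /h (lin_mapB d1L) (lin_mapB (bl _)) !(lin_mapB (br _)).
    rewrite (b11C (sigma1 w) x).
    have -> : b11 x x - b11 x (sigma1 w) - (b11 x (sigma1 w) - b11 (sigma1 w) (sigma1 w))
       = b11 x x - b11 x (sigma1 w) *+ 2 + b11 (sigma1 w) (sigma1 w).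
      by rewrite opprB mulr2n opprD !addrA [LHS]addrAC.
    rewrite scalerDr scalerBr -[b11 x _ *+ 2]scaler_nat scalerA mulVf ?pnatr_eq0 // scale1r.
    by rewrite !addrA; congr (_ - _ + _); rewrite addrAC.
  rewrite mcx sub0r (lin_mapD p2L) (lin_mapB p2L) (lin_mapN p2L) (lin_mapZ p2L) => /eqP.
  by rewrite /T -oppr_eq0 !opprD !opprK => /eqP.
have Mc : M x @[x --> Q] --> M Q.
  apply: cvg_mx_entry => i j; rewrite /M mxE; under eq_fun do rewrite mxE.
  apply: (@cvg_entry _ _ _ _ (nbhs Q) _ (T^~ (delta_mx 0 i))).
  apply: cvgB; first apply: cvgD.
  - exact: cvg_cst.
  - have bc : b11 x (sigma1 (delta_mx 0 i)) @[x --> Q] --> b11 Q (sigma1 (delta_mx 0 i)).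
      apply: (@continuous_comp _ _ _ (fun x => (x, sigma1 (delta_mx 0 i)))
        (fun x : G1 * G1 => b11 x.1 x.2)); last exact: b11c.
      by apply: cvg_pair; [exact: cvg_id|exact: cvg_cst].
    exact: cvg_comp _ _ bc (p2c _).
  - pose k w := 2%:R^-1 *: p2 (b11 (sigma1 w) (sigma1 (delta_mx 0 i))).
    have kL : lin_map k.
      by move=> a w w'; rewrite /k s1L br p2L scalerDr !scalerA [a * _]mulrC.
    exact: cvg_comp _ _ (p1c Q) (lin_map_continuous _ _ _ k kL _).
(* [inj] says that [E] and [M Q] have no common kernel, whence a right inverse [K]. The product with
   [K] stays invertible near [Q], by continuity of the determinant. *)
have [K TK] : exists K, row_mx E (M Q) *m K = 1%:M.
  apply/row_freeP; apply: inj_row_free => w.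
  rewrite mul_mx_row -[0]row_mx0 => /eq_row_mx[wE wM]; apply: inj => //.
  by rewrite -TQ (lin_map_mulmx _ _ _ _ _ (TL Q)).
have detc : \det (row_mx E (M x) *m K) @[x --> Q] --> (1 : R).
  rewrite -(det1 R n1) -TK; apply: cvg_det; apply: cvg_mulmxr.
  apply: cvg_mx_entry => i j; rewrite mxE; under eq_fun do rewrite mxE.
  by case: (fintype.split j) => k; [exact: cvg_cst|exact: cvg_entry].
have : \forall x \near Q, 0 < \det (row_mx E (M x) *m K).
  exact: (detc _ (lt_nbhsr ltr01)).
apply: filterS => x det_gt0 mcx xE.
have Tu : row_mx E (M x) *m K \in unitmx by rewrite unitmxE unitfE gt_eqF.
rewrite -[p1 x](mulmxK Tu) mulmxA mul_mx_row xE.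
by rewrite -(lin_map_mulmx _ _ _ _ _ (TL x)) T0 // row_mx0 !mul0mx.
Qed.

Theorem mainTheorem1
  (R : realType) (G0 G1 G2 : tvsType R)
  (d0 : G0 -> G1) (d1 : G1 -> G2)
  (b00 : G0 -> G0 -> G0) (b01 : G0 -> G1 -> G1)
  (b02 : G0 -> G2 -> G2) (b11 : G1 -> G1 -> G2)
  (hg : is_dgla012 d0 d1 b00 b01 b02 b11)
  (H0 : set G0) (H1 : set G1) (H2 : set G2)
  (hh : is_sub_dgla012 d0 d1 b00 b01 b02 b11 H0 H1 H2)
  (n0 n1 n2 : nat)
  (p0 : G0 -> 'rV[R]_n0) (p1 : G1 -> 'rV[R]_n1) (p2 : G2 -> 'rV[R]_n2)
  (hp0 : is_quotient_map H0 p0) (hp1 : is_quotient_map H1 p1)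
  (hp2 : is_quotient_map H2 p2)
  (sigma0 : 'rV[R]_n0 -> G0) (sigma1 : 'rV[R]_n1 -> G1)
  (hs0 : is_splitting p0 sigma0) (hs1 : is_splitting p1 sigma1)
  (Q : G1) (hQh : H1 Q) (hQ : isMC d1 b11 Q)
  (* (a) *)
  (hp0c : continuous p0) (hp1c : continuous p1) (hp2c : continuous p2)
  (* (b) *)
  (hd1c : continuous d1)
  (* (c) *)
  (hb11c : continuous (fun x : G1 * G1 => b11 x.1 x.2))
  (* (d) *)
  (U : set 'rV[R]_n0) (hUo : open U) (hU0 : U 0)
  (Phi : 'rV[R]_n0 -> G1 -> G1)
  (hPhi : forall v Q', U v -> gauge_rel d0 b01 Q' (sigma0 v) (Phi v Q'))
  (hPhic : {within [set x : 'rV[R]_n0 * G1 | U x.1],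
             continuous (fun x : 'rV[R]_n0 * G1 => Phi x.1 x.2)})
  (hPhis : forall Q' : G1, smooth_on U (fun v => p1 (Phi v Q')))
  (* (e) *)
  (hMC : forall v Q', U v -> (isMC d1 b11 Q' <-> isMC d1 b11 (Phi v Q')))
  (* H^1(g/h, dbar) = 0, with dbar the differential induced by d + [Q,-] *)
  (hH1 : forall w : 'rV[R]_n1,
     p2 (d1 (sigma1 w) + b11 Q (sigma1 w)) = 0 ->
     exists u : 'rV[R]_n0, p1 (d0 (sigma0 u) - b01 (sigma0 u) Q) = w) :
  let H0bar := [set w : 'rV[R]_n0 | p1 (d0 (sigma0 w) - b01 (sigma0 w) Q) = 0] in
  forall V : set 'rV[R]_n0, open V -> V 0 -> V `<=` U ->
  exists UU : set G1,
    [/\ (exists O : set G1, open O /\ UU = O `&` [set Q' | isMC d1 b11 Q']),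
        UU Q &
        forall Q', UU Q' ->
          exists (O0 : set 'rV[R]_n0) (phi : 'rV[R]_n0 -> 'rV[R]_n0),
            [/\ (exists O' : set 'rV[R]_n0, open O' /\ O0 = O' `&` H0bar),
                O0 0,
                (forall x y, O0 x -> O0 y -> phi x = phi y -> x = y),
                phi @` O0 `<=` V &
                forall v, (phi @` O0) v -> H1 (Phi v Q')]].
Proof.
move=> H0bar V Vo V0 VU.
have [p1L [_ p1H]] := hp1; have [s0L _] := hs0.
have d0L := dgla_d0_lin hg; have b01L := dgla_b01_bilin hg.
have br a : lin_map (b01^~ a) by move=> k y y'; exact: b01L.1.
pose D w := p1 (d0 (sigma0 w) - b01 (sigma0 w) Q).
have DL : lin_map D.
  move=> a w w'; rewrite /D s0L d0L br opprD addrACA -scalerBr; exact: p1L.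
pose A := \matrix_i D (delta_mx 0 i).
have DA w : D w = w *m A by exact: lin_map_mulmx.
pose r := \rank A.
(* The rank factorization [A = col_base A *m row_base A] of the matrix of [D]: one-sided inverses of
   the factors give [B] and [E] with [B *m A *m E = 1]. *)
have [B BK] : exists B, B *m col_base A = 1%:M :> 'M[R]_r.
  by apply/row_fullP; exact: col_base_full.
have [E EK] : exists E, row_base A *m E = 1%:M :> 'M[R]_r.
  by apply/row_freeP; exact: row_base_free.
have AE : A *m E = col_base A by rewrite -{1}(mulmx_base A) -mulmxA EK mulmx1.
have BAE : B *m A *m E = 1%:M by rewrite -mulmxA AE.
have U0 : nbhs (0 : 'rV[R]_n0) U by exact: open_nbhs_nbhs.
have Phi0 : Phi 0 Q = Q.
  apply: (@gauge_rel_sol _ _ _ d0 b01 Q _ (sigma0 0) (fun=> Q)); first exact: hPhi.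
  by rewrite (lin_map0 s0L); exact: gauge_sol0.
have Phic v Q' : U v -> {for (v, Q'), continuous (fun x : 'rV[R]_n0 * G1 => Phi x.1 x.2)}.
  move=> Uv; move: hPhic; rewrite continuous_open_subspace.
    by apply; rewrite inE.
  by apply: (@open_comp _ _ fst U) => // x _; exact: cvg_fst.
pose f v := p1 (Phi v Q).
have f0 : f 0 = 0 by rewrite /f Phi0; exact/p1H.
have rig : \forall x \near Q, isMC d1 b11 x -> p1 x *m E = 0 -> p1 x = 0.
  apply: (@isMC_rigidity _ _ _ d1 b11 H1 H2 _ _ _ p1 p2 sigma1 Q E) => //.
  - exact: dgla_d1_lin hg.
  - exact: dgla_b11_bilin hg.
  - exact: dgla_b11_sym hg.
  - exact: sub_H2 hh.
  - exact: sub_d1 hh.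
  - exact: sub_b11 hh.
  (* A cocycle [w] equals [u *m A] by vanishing of H^1; [E] then reads off [u *m col_base A], whose
     vanishing forces [w = 0]. *)
  move=> w wE /hH1[u uw]; move: wE; rewrite -uw -/(D u) DA -mulmxA AE => uc.
  by rewrite -{1}(mulmx_base A) mulmxA uc mul0mx.
pose O1 := interior [set x | isMC d1 b11 x -> p1 x *m E = 0 -> p1 x = 0].
have [CE CE0 CEle] := norm_mulmxr_le _ _ _ E.
have [CB CB0 CBle] := norm_mulmxr_le _ _ _ B.
(* With this [e], the linearization error at [c *m B], read through [E], is at most a quarter of the
   norm of [c]. *)
pose e : R := (4 * CE * CB)^-1.
have e0 : 0 < e by rewrite invr_gt0 !mulr_gt0.
have near0 : \forall v \near (0 : 'rV[R]_n0),
    [/\ V v, O1 (Phi v Q) & `|f v + v *m A| <= e * `|v|].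
  have nV : nbhs (0 : 'rV[R]_n0) V by exact: open_nbhs_nbhs.
  have nO : \forall v \near (0 : 'rV[R]_n0), O1 (Phi v Q).
    have c0 : Phi v Q @[v --> (0 : 'rV[R]_n0)] --> Phi 0 Q.
      have vQ : (fun v => (v, Q)) @ (0 : 'rV[R]_n0) --> ((0 : 'rV[R]_n0), Q).
        exact: (cvg_pair_pt cvg_id (cvg_cst Q)).
      exact: (cvg_comp _ _ vQ (Phic _ _ hU0)).
    by apply: c0; rewrite Phi0; exact: nbhs_interior.
  (* The gauge equation and [D] carry opposite signs, whence [- A]. *)
  have nf : \forall v \near (0 : 'rV[R]_n0), `|f v - f 0 - v *m (- A)| <= e * `|v|.
    apply: (@differentiable0_of_partials _ _ _ U) => //.
    - by move=> x i Ux; exact: (hPhis Q [::] x Ux).1.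
    - by move=> i; exact: (hPhis Q [:: delta_mx 0 i] 0 hU0).2.
    - move=> i; rewrite (@derive_gauge_orbit _ _ _ d0 b01 _ _ _ _ p1 sigma0 U Q (Phi^~ Q)) //.
      + by rewrite rowE mulmxN -DA /D -(lin_mapN p1L) opprB.
      + by move=> v Uv; exact: hPhi.
      + exact: (hPhis Q [::] 0 hU0).1.
  near=> v; split; [by near: v|by near: v|].
  have : `|f v - f 0 - v *m (- A)| <= e * `|v| by near: v.
  by rewrite f0 subr0 mulmxN opprK.
have Bc : (fun c : 'rV[R]_r => c *m B) @ (0 : 'rV[R]_r) --> (0 : 'rV[R]_n0).
  rewrite -[X in _ --> X](mul0mx _ B).
  by apply: (@cvg_mulmxr _ _ _ _ _ (nbhs (0 : 'rV[R]_r))); exact: cvg_id.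
have /nbhs_ballP[d /= dpos] := Bc _ near0; rewrite -ball_normE => dB.
(* Halving [d] fits the closed box, which is compact, inside the open ball. *)
pose rho := d / 2; have rho0 : 0 < rho by rewrite divr_gt0.
have {}dB (c : 'rV[R]_r) : `|c| <= rho ->
    [/\ V (c *m B), O1 (Phi (c *m B) Q) & `|f (c *m B) *m E + c| < rho / 2].
  move=> cr; have [|Vc Oc fc] := dB c.
    by rewrite /= sub0r normrN; apply: le_lt_trans cr _; rewrite /rho; lra.
  split => //.
  have -> : f (c *m B) *m E + c = (f (c *m B) + c *m B *m A) *m E.
    by rewrite mulmxDl -!mulmxA [B *m _]mulmxA BAE mulmx1.
  apply: le_lt_trans (CEle _) _.
  apply: (@le_lt_trans _ _ (CE * (e * (CB * `|c|)))).
    rewrite ler_pM2l //; apply: le_trans fc _; rewrite ler_pM2l //; exact: CBle.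
  have -> : CE * (e * (CB * `|c|)) = `|c| / 4.
    by rewrite /e; field; rewrite !gt_eqF.
  lra.
pose Psi (k : 'rV[R]_n0) Q' (c : 'rV[R]_r) := p1 (Phi (k + c *m B) Q') *m E.
pose P (i : 'rV[R]_n0 * G1) (c : 'rV[R]_r) :=
  [/\ V (i.1 + c *m B), O1 (Phi (i.1 + c *m B) i.2) & `|Psi i.1 i.2 c + c| < rho / 2].
(* Compactness of the closed box makes the three conditions hold for all its [c] at once, for
   [(k, Q')] in a product of neighbourhoods independent of [c]. *)
have [[N1 N2] /= [N1n N2n] N12] :
    \forall i \near nbhs ((0 : 'rV[R]_n0), Q), [set c : 'rV[R]_r | `|c| <= rho] `<=` P i.
  apply: (compact_near_coveringP _).1; first exact: compact_norm_le.
  move=> c /dB[Vc Oc fc].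
  pose Z := ('rV[R]_r * ('rV[R]_n0 * G1))%type.
  pose z0 : Z := (c, (0, Q)).
  have vc : z.2.1 + z.1 *m B @[z --> z0] --> c *m B.
    rewrite -[X in _ --> X]add0r.
    apply: cvgD; first exact: (cvg_comp _ _ cvg_snd cvg_fst).
    by apply: (@cvg_mulmxr _ _ _ _ _ (nbhs z0)); exact: cvg_fst.
  have Qc : z.2.2 @[z --> z0] --> Q by exact: (cvg_comp _ _ cvg_snd cvg_snd).
  have Pc : Phi (z.2.1 + z.1 *m B) z.2.2 @[z --> z0] --> Phi (c *m B) Q.
    exact: (cvg_comp _ _ (cvg_pair_pt vc Qc) (Phic _ _ (VU _ Vc))).
  have Sc : Psi z.2.1 z.2.2 z.1 + z.1 @[z --> z0] --> f (c *m B) *m E + c.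
    apply: cvgD; last exact: cvg_fst.
    by apply: (@cvg_mulmxr _ _ _ _ _ (nbhs z0)); exact: (cvg_comp _ _ Pc (hp1c _)).
  have nearV : \forall z \near z0, V (z.2.1 + z.1 *m B).
    by apply: vc; exact: open_nbhs_nbhs.
  have nearO : \forall z \near z0, O1 (Phi (z.2.1 + z.1 *m B) z.2.2).
    by apply: Pc; apply: open_nbhs_nbhs; split => //; exact: open_interior.
  have nearPsi : \forall z \near z0, `|Psi z.2.1 z.2.2 z.1 + z.1| < rho / 2.
    have Nc : `|Psi z.2.1 z.2.2 z.1 + z.1| @[z --> z0] --> `|f (c *m B) *m E + c|.
      exact: (@cvg_norm _ _ _ _ _ _ _ Sc).
    exact: (Nc _ (lt_nbhsl fc)).
  have : \forall z \near z0, P z.2 z.1 by near=> z; split; near: z.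
  move=> [[X Y] /= [Xn Yn] XY]; exists (X, Y) => //= -[x y] /=; exact: (XY (x, y)).
exists (interior N2 `&` [set Q' | isMC d1 b11 Q']); split.
- by exists (interior N2); split => //; exact: open_interior.
- by split.
move=> Q' [/interior_subset N2Q' mcQ'].
(* Choice requires a value for every [k]; outside [interior N1] it is 0, with nothing to prove. *)
have sol k : exists c : 'rV[R]_r, interior N1 k ->
    V (k + c *m B) /\ H1 (Phi (k + c *m B) Q').
  have [/interior_subset N1k|nk] := pselect (interior N1 k); last by exists 0.
  have PkQ := N12 (k, Q') (conj N1k N2Q').
  have [c cr /eqP] : exists2 c : 'rV[R]_r, `|c| <= rho & - Psi k Q' c = 0.
    have gi (c : 'rV[R]_r) i : `|c| <= rho -> `|Psi k Q' c 0 i + c 0 i| < rho / 2.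
      move=> /PkQ[_ _]; apply: le_lt_trans.
      by have := norm_entry_le _ _ _ (Psi k Q' c + c) 0 i; rewrite mxE.
    (* Since [- Psi] differs from [c] by less than [rho / 2], its entry [i] has the sign of [c 0 i]
       on the faces [c 0 i = rho] and [c 0 i = - rho]. *)
    apply: (@poincare_miranda _ _ rho) => //.
    + move=> c /PkQ[/VU Uc _ _].
      suff Sc : Psi k Q' z @[z --> c] --> Psi k Q' c by exact: cvgN Sc.
      apply: (@cvg_mulmxr _ _ _ _ _ (nbhs c)).
      have vc : k + z *m B @[z --> c] --> k + c *m B.
        apply: (@cvgD _ _ _ (nbhs c)); first exact: cvg_cst.
        by apply: (@cvg_mulmxr _ _ _ _ _ (nbhs c)); exact: cvg_id.
      have Pc : Phi (k + z *m B) Q' @[z --> c] --> Phi (k + c *m B) Q'.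
        exact: (cvg_comp _ _ (cvg_pair_pt vc (cvg_cst Q')) (Phic _ _ Uc)).
      exact: (cvg_comp _ _ Pc (hp1c _)).
    + move=> c i /(gi c i) + ci; rewrite ci ltr_norml => /andP[_ Psi_lt].
      have -> : (- Psi k Q' c) 0 i = - Psi k Q' c 0 i by rewrite mxE.
      lra.
    + move=> c i /(gi c i) + ci; rewrite ci ltr_norml => /andP[Psi_gt _].
      have -> : (- Psi k Q' c) 0 i = - Psi k Q' c 0 i by rewrite mxE.
      lra.
  rewrite oppr_eq0 => /eqP Psi0; exists c => _.
  have [Vc /interior_subset Oc _] := PkQ _ cr; split => //.
  (* By (e) the transformed element is Maurer-Cartan, so rigidity on [O1] turns vanishing of its
     [E]-coordinates into membership in [H1]. *)
  by apply/p1H; apply: Oc; [exact: (hMC _ _ (VU _ Vc)).1|exact: Psi0].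
have [ch chP] := choice sol.
exists (interior N1 `&` H0bar), (fun k => k + ch k *m B); split.
- by exists (interior N1); split => //; exact: open_interior.
- by split => //; rewrite /H0bar /= -/(D 0) (lin_map0 DL).
(* The projection [1 - col_base A *m B] kills the image of [B], as [B *m col_base A = 1], and fixes
   the kernel of [D], so it recovers [k]. *)
- have back k : H0bar k -> (k + ch k *m B) *m (1%:M - col_base A *m B) = k.
    rewrite /H0bar /= -/(D k) DA => kA.
    have kc : k *m col_base A = 0 by rewrite -AE mulmxA kA mul0mx.
    rewrite mulmxBr mulmx1 mulmxDl (mulmxA k) kc mul0mx add0r.
    by rewrite (mulmxA (ch k *m B)) -(mulmxA (ch k) B) BK mulmx1 addrK.
  by move=> x y [_ /back xE] [_ /back yE] xy; rewrite -xE -yE xy.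
- by move=> _ [k [N1k _] <-]; exact: (chP k N1k).1.
- by move=> _ [k [N1k _] <-]; exact: (chP k N1k).2.
Unshelve. all: by end_near. Qed.
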